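(* The $4$-webs $NW$ exist, and the general solution of the system of equations defining such webs depends on one arbitrary function of two variables.
   Context: Let $M^2$ be a two-dimensional analytic manifold. A $4$-web is given in an open domain $D\subset M^2$ by four foliations $X_1,X_2,X_3,X_4$ of curves such that the tangents to the curves of different foliations through any point of $D$ are distinct, and two curves of different foliations have at most one common point in $D$. All functions and forms are real of class $C^\infty$ (or holomorphic in the complex case). The foliation $X_\alpha$, $\alpha=1,2,3$, is defined by $\omega_\alpha=0$, where the $1$-forms are normalized so that $\omega_1+\omega_2+\omega_3=0$. There is a unique $1$-form $\theta$ with $d\omega_\alpha=\omega_\alpha\wedge\theta$, and the curvature $K$ of the $3$-subweb $[1,2,3]$ is defined by $d\theta=K\,\omega_1\wedge\omega_2$; one has $dK-2K\theta=K_1\omega_1+K_2\omega_2$. The foliation $X_4$ is defined by $\omega_4=0$, where $-\omega_4=a\omega_1+\omega_2$; the function $a\neq0,1$ is the basic invariant, and $da=a_1\omega_1+a_2\omega_2$. A web $NW$ is a $4$-web with a constant basic invariant ($a_1=a_2=0$) and equal curvature forms of its four $3$-subwebs (when $a_1=a_2=0$ all four curvature forms automatically equal $K\,\omega_1\wedge\omega_2$). The system of equations defining webs $NW$ consists of the structure equations $d\omega_\alpha=\omega_\alpha\wedge\theta$, $d\theta=K\omega_1\wedge\omega_2$ and the Pfaffian equations $dK-2K\theta=K_1\omega_1+K_2\omega_2$ and $da=0$. ''Depends on $k$ functions of $m$ variables'' is meant in the sense of Cartan's theory of exterior differential systems in involution (the last nonzero Cartan character is $s_m=k$). *)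

(* Defs.v *)
From HB Require Import structures.
From Stdlib Require Import Relation_Operators.
From mathcomp Require Import all_boot all_order all_algebra.
From mathcomp Require Import all_classical all_reals all_analysis.
From mathcomp Require Export complex.
Set Implicit Arguments.
Unset Strict Implicit.
Unset Printing Implicit Defensive.
Import Order.TTheory GRing.Theory Num.Theory.
Import numFieldNormedType.Exports.
Local Open Scope classical_set_scope.
Local Open Scope ring_scope.

(** * Webs on plane domains

    [K] is the ground field: the reals for C^oo webs, or the complex numbers
    for holomorphic webs.  Since the theory is local, a surface is replaced by
    the domain of a chart. *)

Section PlaneForms.
Variable K : numFieldType.
Local Notation plane := 'rV[K]_2.

Definition partial (i : 'I_2) (f : plane -> K) : plane -> K :=
  fun p => derive (f : plane -> K^o) p (delta_mx 0 i).

Fixpoint Ck (k : nat) (D : set plane) (f : plane -> K) : Prop :=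
  (forall p, D p -> {for p, continuous f}) /\
  match k with
  | 0 => True
  | k'.+1 => forall i : 'I_2,
      (forall p, D p -> derivable (f : plane -> K^o) p (delta_mx 0 i)) /\
      Ck k' D (partial i f)
  end.

(* Over the complex numbers the derivatives are complex derivatives, so that
   this says that [f] is holomorphic on the open set [D]. *)
Definition smooth (D : set plane) (f : plane -> K) : Prop :=
  forall k, Ck k D f.

(* The 1-form w_0 dx + w_1 dy is represented by p |-> (w_0 p, w_1 p), and a
   2-form by its coefficient on dx /\ dy. *)
Definition smooth_form (D : set plane) (w : plane -> plane) : Prop :=
  forall i, smooth D (fun p => w p 0 i).

Definition wedge1 (u v : plane) : K := u 0 0 * v 0 1 - u 0 1 * v 0 0.

Definition dform (w : plane -> plane) : plane -> K :=
  fun p => partial 0 (fun q => w q 0 1) p - partial 1 (fun q => w q 0 0) p.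

(* [p] and [q] are joined by one parametrized integral curve of [w = 0] in [D];
   the parameter ranges over a disc when [K] is the field of complex numbers. *)
Definition integral_arc (D : set plane) (w : plane -> plane) (p q : plane)
    : Prop :=
  exists (c : K -> plane) (r s : K),
    [/\ `|s| < r, c 0 = p, c s = q &
        forall t, `|t| < r ->
          [/\ D (c t), derivable (c : K^o -> plane) t 1 &
              \sum_(i < 2)
                w (c t) 0 i * (derive (c : K^o -> plane) t 1) 0 i = 0]].

(* [p] and [q] lie on the same curve of the foliation [w = 0] of [D]. *)
Definition same_leaf (D : set plane) (w : plane -> plane) (p q : plane) : Prop :=
  D p /\ clos_refl_trans plane (integral_arc D w) p q.

(* [X i] is any 1-form defining the i-th foliation. *)
Definition is_4web (D : set plane) (X : 'I_4 -> plane -> plane) : Prop :=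
  [/\ open D, connected D, D !=set0 &
   (forall i, smooth_form D (X i)) /\
   forall i j, i != j ->
     (forall p, D p -> wedge1 (X i p) (X j p) != 0) /\
     (forall p q, same_leaf D (X i) p q -> same_leaf D (X j) p q -> p = q)].

(* [w] defines the same foliations of [D] as [X]. *)
Definition rescaling (I : Type) (D : set plane) (X w : I -> plane -> plane)
    : Prop :=
  forall i, smooth_form D (w i) /\
    exists2 f : plane -> K, smooth D f &
      forall p, D p -> f p != 0 /\ w i p = f p *: X i p.

Definition is_basic_invariant (D : set plane) (X : 'I_4 -> plane -> plane)
    (a : plane -> K) : Prop :=
  smooth D a /\
  exists w : 'I_4 -> plane -> plane,
    [/\ rescaling D X w,
        forall p, D p -> w 0 p + w 1 p + w 2 p = 0 &
        forall p, D p -> - w 3 p = a p *: w 0 p + w 1 p].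

Definition is_curvature_form (D : set plane) (X : 'I_3 -> plane -> plane)
    (Om : plane -> K) : Prop :=
  exists (w : 'I_3 -> plane -> plane) (theta : plane -> plane),
    [/\ rescaling D X w,
        forall p, D p -> \sum_(i < 3) w i p = 0,
        smooth_form D theta,
        forall i p, D p -> dform (w i) p = wedge1 (w i p) (theta p) &
        forall p, D p -> Om p = dform theta p].

(* [fun j => X (lift i j)] is the 3-subweb obtained by dropping foliation [i]. *)
Definition is_NW_web (D : set plane) (X : 'I_4 -> plane -> plane) : Prop :=
  [/\ is_4web D X,
      exists a : K, is_basic_invariant D X (fun=> a) &
      exists Om : plane -> K,
        forall i : 'I_4, is_curvature_form D (fun j => X (lift i j)) Om].

End PlaneForms.

(** * Exterior differential systems given by structure equations

    The unknowns are [n] independent 1-forms eta^0, ..., eta^(n-1) (a coframe)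
    and [m] functions z^0, ..., z^(m-1).  The system prescribes the d eta^i and
    the vanishing of [p] further 1-forms, all of them expressed through z, eta
    and dz.  At a value of z, the 1-forms eta^i, dz^j are the coordinates
    of a vector [X = row_mx (eta X) (dz X)] of K^(n+m). *)

Section StructureEquations.
Variables (K : numFieldType) (n m : nat).
Local Notation vec := 'rV[K]_(n + m).

Definition form1 := 'rV[K]_m -> vec -> K.
Definition form2 := 'rV[K]_m -> vec -> vec -> K.

Definition eta (i : 'I_n) : form1 := fun _ X => X 0 (lshift m i).
Definition dz (j : 'I_m) : form1 := fun _ X => X 0 (rshift n j).
Definition wedge (f g : form1) : form2 :=
  fun z X Y => f z X * g z Y - f z Y * g z X.

Record structure_system (p : nat) := StructureSystem {
  admissible : set 'rV[K]_m ;
  deta : 'I_n -> form2 ;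
  pfaff : 'I_p -> form1 }.

Variables (p : nat) (S : structure_system p).

(* In the frame dual to (eta, dz) one has [X, Y] = - bracket z X Y for constant
   X and Y, because d(dz^j) = 0.  The next two definitions are then the usual
     d f (X, Y) = X f(Y) - Y f(X) - f [X, Y]
   and its analogue for 2-forms; coefficients depend on z only. *)
Definition bracket (z : 'rV[K]_m) (X Y : vec) : vec :=
  row_mx (\row_i deta S i z X Y) 0.

Definition along (X : vec) (f : 'rV[K]_m -> K) (z : 'rV[K]_m) : K :=
  derive (f : 'rV[K]_m -> K^o) z (rsubmx X).

Definition d1 (f : form1) (z : 'rV[K]_m) (X Y : vec) : K :=
  along X (f ^~ Y) z - along Y (f ^~ X) z + f z (bracket z X Y).

Definition d2 (f : form2) (z : 'rV[K]_m) (X Y Z : vec) : K :=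
  along X (fun t => f t Y Z) z - along Y (fun t => f t X Z) z
  + along Z (fun t => f t X Y) z
  + f z (bracket z X Y) Z - f z (bracket z X Z) Y + f z (bracket z Y Z) X.

(* The row space of [E] annihilates the closed system: the Pfaffian forms,
   their exterior derivatives, and the d(d eta^i). *)
Definition integral_element (z : 'rV[K]_m) (k : nat) (E : 'M[K]_(k, n + m))
    : Prop :=
  [/\ forall i X, (X <= E)%MS -> pfaff S i z X = 0,
      forall i X Y, (X <= E)%MS -> (Y <= E)%MS -> d1 (pfaff S i) z X Y = 0 &
      forall i X Y Z, (X <= E)%MS -> (Y <= E)%MS -> (Z <= E)%MS ->
        d2 (deta S i) z X Y Z = 0].

(* The polar space H(E), i.e. the set of v such that E + <v> is an integral
   element, is a linear subspace of codimension [c]. *)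
Definition polar_codim (z : 'rV[K]_m) (k : nat) (E : 'M[K]_(k, n + m))
    (c : nat) : Prop :=
  exists2 H : 'M[K]_(n + m),
    forall v : vec, (v <= H)%MS <-> integral_element z (E + v)%MS &
    (\rank H + c = n + m)%N.

(* [c] is the codimension of the polar space of a generic [k]-dimensional
   subspace of [E]. *)
Definition generic_polar_codim (z : 'rV[K]_m) (E : 'M[K]_(n, n + m))
    (k c : nat) : Prop :=
  (exists F : 'M[K]_(k, n + m),
     [/\ row_free F, (F <= E)%MS & polar_codim z F c]) /\
  (forall (F : 'M[K]_(k, n + m)) (c' : nat),
     row_free F -> (F <= E)%MS -> polar_codim z F c' -> (c' <= c)%N).

(* s 0, ..., s n are the Cartan characters of the n-dimensional integral
   element [E]: s 0 + ... + s k is the k-th generic polar codimension for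
   k < n, and s 0 + ... + s n is the codimension of [E]. *)
Definition cartan_characters (z : 'rV[K]_m) (E : 'M[K]_(n, n + m))
    (s : nat -> nat) : Prop :=
  (forall k, (k < n)%N -> generic_polar_codim z E k (\sum_(j < k.+1) s j)%N) /\
  (n + \sum_(j < n.+1) s j = n + m)%N.

(* The n-plane dz = eta *m A; these are the n-planes on which the eta^i are
   independent. *)
Definition plane_of (A : 'M[K]_(n, m)) : 'M[K]_(n, n + m) := row_mx 1%:M A.

(* Cartan's test: the integral elements at [z] depend on N = \dim W parameters
   and N = s 1 + 2 s 2 + ... + n s n.  For a system linear in the derivatives,
   as here, the integral elements form an affine space. *)
Definition in_involution_at (z : 'rV[K]_m) (s : nat -> nat) : Prop :=
  exists (A0 : 'M[K]_(n, m)) (W : {vspace 'M[K]_(n, m)}),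
    [/\ forall A, integral_element z (plane_of A) <-> A - A0 \in W,
        forall A, integral_element z (plane_of A) ->
          cartan_characters z (plane_of A) s &
        \dim W = (\sum_(k < n.+1) k * s k)%N].

(* The system is in involution and its last nonzero Cartan character is
   s q = k. *)
Definition general_solution_depends_on (k q : nat) : Prop :=
  exists s : nat -> nat,
    [/\ forall z, admissible S z -> in_involution_at z s,
        (q <= n)%N, (0 < k)%N, s q = k &
        forall j, (q < j <= n)%N -> s j = 0%N].

End StructureEquations.

(* The coframe is (w_1, w_2, theta) and the functions are (a, K, K_1, K_2).  The
   forms w_1, w_2, theta are independent on the 3-dimensional manifold of
   normalized coframes (w_1, w_2) of the web, theta being defined on the surface
   only after a choice of normalization; so solutions are counted up to
   changes of coordinates and of normalization.  The equation of w_3 is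
   omitted: it follows from w_3 = - w_1 - w_2. *)
Definition NW_system (F : numFieldType) : structure_system F 3 4 2 :=
  let w1 : form1 F 3 4 := eta 0 in
  let w2 : form1 F 3 4 := eta 1 in
  let theta : form1 F 3 4 := eta 2 in
  let a (z : 'rV[F]_4) := z 0 0 in
  let K (z : 'rV[F]_4) := z 0 1 in
  let K1 (z : 'rV[F]_4) := z 0 2 in
  let K2 (z : 'rV[F]_4) := z 0 3 in
  let da : form1 F 3 4 := dz 0 in
  let dK : form1 F 3 4 := dz 1 in
  {| admissible := [set z | a z != 0 /\ a z != 1] ;
     deta := fun i =>
       if i == 0 then wedge w1 theta
       else if i == 1 then wedge w2 theta
       else fun z X Y => K z * wedge w1 w2 z X Y ;
     pfaff := fun i =>
       if i == 0 then
         fun z X => dK z X - 2 * K z * theta z X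
                    - (K1 z * w1 z X + K2 z * w2 z X)
       else da |}.

(* [U] ranges over the chart domains of an arbitrary surface. *)
Definition NW_webs_exist (K : numFieldType) : Prop :=
  forall U : set 'rV[K]_2, open U -> U !=set0 ->
    exists (D : set 'rV[K]_2) (X : 'I_4 -> 'rV[K]_2 -> 'rV[K]_2),
      D `<=` U /\ is_NW_web D X.

(* Main.v *)
(** The web of the four families of parallel lines dx = 0, dy = 0, dx + dy = 0
    and dx - dy = 0, restricted to a ball, has constant basic invariant -1 and
    flat 3-subwebs: any three constant forms are rescaled by constants to a zero
    sum, with theta = 0.  The corresponding linear functions are constant along
    leaves, so leaves of different foliations meet at most once.

    For the exterior differential system, the d(d eta^i) lie in the ideal of the
    Pfaffian forms, so the only 2-form to consider is the exterior derivative of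
    dK - 2 K theta - K1 w1 - K2 w2, which is congruent to - (P1 /\ w1 + P2 /\ w2)
    with P1 = dK1 - 3 K1 theta - K^2 w2 and P2 = dK2 - 3 K2 theta + K^2 w1.
    By Cartan's lemma the integral planes are P1 = p w1 + q w2, P2 = q w1 + r w2,
    an affine space of dimension 3, and the generic polar codimensions are 2, 3
    and 4, hence the characters are 2, 1, 1, 0 and 1 + 2 * 1 = 3. *)
From HB Require Import structures.
Require Import Defs.
From mathcomp Require Import all_boot all_order all_algebra ring.
From mathcomp Require Import all_classical all_reals all_analysis.
Set Implicit Arguments.
Unset Strict Implicit.
Unset Printing Implicit Defensive.
Import Order.TTheory GRing.Theory Num.Theory.
Import numFieldNormedType.Exports.
Local Open Scope classical_set_scope.
Local Open Scope ring_scope.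

(** * Derivatives of affine functions and small index sets *)

(** The difference quotient is the constant [l] away from 0. All coefficients of the system are
    affine in [z], so this computes every [along]. *)
Lemma derive_affine (K : numFieldType) (V : normedModType K) (f : V -> K)
    (x v : V) (l : K) :
  (forall h, f (h *: v + x) - f x = h * l) -> derive (f : V -> K^o) x v = l.
Proof.
move=> fE; rewrite /derive; apply: cvg_lim => //.
apply: (@cvg_trans _ ((cst l : K -> K^o) @ 0^')); last exact: cvg_cst.
apply: near_eq_cvg; near=> h => /=.
have h0 : h != 0 by near: h; exact: nbhs_dnbhs_neq.
by rewrite fE /GRing.scale /= mulrA mulVf ?mul1r.
Unshelve. all: by end_near. Qed.

(** Reduces a linear consequence of [l = r] to a ring identity. *)
Lemma eq0_sub (V : zmodType) (x l r : V) : l = r -> x = r - l -> x = 0.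
Proof. by move=> -> ->; rewrite subrr. Qed.

Lemma ord2P (i : 'I_2) : i = 0 \/ i = 1.
Proof. by case: i => -[|[|//]] ?; [left|right]; apply: val_inj. Qed.

Lemma ord3P (i : 'I_3) : [\/ i = 0, i = 1 | i = 2].
Proof.
by case: i => -[|[|[|//]]] ?;
  [constructor 1|constructor 2|constructor 3]; apply: val_inj.
Qed.

Lemma ord4P (i : 'I_4) : [\/ i = 0, i = 1, i = 2 | i = 3].
Proof.
by case: i => -[|[|[|[|//]]]] ?;
  [constructor 1|constructor 2|constructor 3|constructor 4]; apply: val_inj.
Qed.

(** * Exterior derivatives of the structure equations *)

Section NWSystem.
Variable F : numFieldType.
Local Notation vec := 'rV[F]_(3 + 4).
Local Notation S := (NW_system F).
Local Notation w1 := (@eta F 3 4 0).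
Local Notation w2 := (@eta F 3 4 1).
Local Notation theta := (@eta F 3 4 2).
Local Notation dK := (@dz F 3 4 1).
Local Notation dK1 := (@dz F 3 4 2).
Local Notation dK2 := (@dz F 3 4 3).

(** Here d(dK) = 0, and the last three terms come from d w1, d w2 and d theta; nothing is reduced
    modulo the Pfaffian forms. *)
Lemma d1_pfaff0 z X Y :
  d1 S (pfaff S 0) z X Y =
    - 2 * wedge dK theta z X Y - wedge dK1 w1 z X Y - wedge dK2 w2 z X Y
    - z 0 2 * wedge w1 theta z X Y - z 0 3 * wedge w2 theta z X Y
    - 2 * z 0 1 ^+ 2 * wedge w1 w2 z X Y.
Proof.
have al U V : along U ((pfaff S 0) ^~ V) z =
    - 2 * dK z U * theta z V - (dK1 z U * w1 z V + dK2 z U * w2 z V).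
  by apply: derive_affine => h /=; rewrite /dz /eta !mxE; ring.
rewrite /d1 !al /= /dz /eta /bracket !row_mxEl !row_mxEr !mxE /=.
by rewrite /wedge /dz /eta; ring.
Qed.

Lemma d1_pfaff1 z X Y : d1 S (pfaff S 1) z X Y = 0.
Proof.
have al U V : along U ((pfaff S 1) ^~ V) z = 0.
  by apply: derive_affine => h /=; rewrite /dz mulr0 subrr.
by rewrite /d1 !al /= /dz /bracket row_mxEr !mxE; ring.
Qed.

(** d(w1 /\ theta) and d(w2 /\ theta) vanish, while d(K w1 /\ w2) = (dK - 2 K theta) /\ w1 /\ w2;
    the K1 w1 and K2 w2 of the Pfaffian form are killed by w1 /\ w2. *)
Lemma d2_deta z i X Y Z :
  d2 S (deta S i) z X Y Z =
    if i == 2 then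
      pfaff S 0 z X * wedge w1 w2 z Y Z - pfaff S 0 z Y * wedge w1 w2 z X Z
      + pfaff S 0 z Z * wedge w1 w2 z X Y
    else 0.
Proof.
have al U V W : along U (fun t => deta S i t V W) z =
    if i == 2 then dK z U * wedge w1 w2 z V W else 0.
  apply: derive_affine => h /=.
  case: (ord3P i) => -> /=; rewrite ?(subrr, mulr0) //.
  by rewrite /wedge /dz /eta !mxE; ring.
rewrite /d2 !al.
by case: (ord3P i) => -> /=;
  rewrite /bracket /wedge /dz /eta ?row_mxEl ?mxE /= /wedge /eta; ring.
Qed.

Lemma integral_sub z k l (E : 'M[F]_(k, 3 + 4)) (E' : 'M[F]_(l, 3 + 4)) :
  (E' <= E)%MS -> integral_element S z E -> integral_element S z E'.
Proof.
move=> sE [H1 H2 H3]; split=> [i X XE|i X Y XE YE|i X Y Z XE YE ZE].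
- by apply: H1; apply: submx_trans sE.
- by apply: H2; apply: submx_trans sE.
- by apply: H3; apply: submx_trans sE.
Qed.

(** * Integral elements in matrix form *)

(** The columns are the coefficients of the two Pfaffian forms; [lshift 4] indexes the [eta] and
    [rshift 3] the [dz]. *)
Definition pfaff_mx (z : 'rV[F]_4) : 'M[F]_(3 + 4, 1 + 1) :=
  row_mx (delta_mx (rshift 3 1) 0 - (2 * z 0 1) *: delta_mx (lshift 4 2) 0
           - z 0 2 *: delta_mx (lshift 4 0) 0 - z 0 3 *: delta_mx (lshift 4 1) 0)
         (delta_mx (rshift 3 0) 0 : 'cV_(3 + 4)).

Lemma pfaff_mxE z i X : pfaff S i z X = (X *m pfaff_mx z) 0 i.
Proof.
rewrite mul_mx_row !mulmxBr -!scalemxAr -!colE.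
case: (ord2P i) => ->.
  have -> : 0 = lshift 1 (0 : 'I_1) :> 'I_(1 + 1) by apply: val_inj.
  by rewrite row_mxEl !mxE /= /dz /eta; ring.
have -> : 1 = rshift 1 (0 : 'I_1) :> 'I_(1 + 1) by apply: val_inj.
by rewrite row_mxEr !mxE.
Qed.

Definition wedge_mx (a b : 'I_(3 + 4)) : 'M[F]_(3 + 4) :=
  delta_mx a b - delta_mx b a.

Lemma wedge_mxE a b (X Y : vec) :
  (X *m wedge_mx a b *m Y^T) 0 0 = X 0 a * Y 0 b - Y 0 a * X 0 b.
Proof.
rewrite /wedge_mx mulmxBr mulmxBl.
rewrite -(mul_delta_mx (0 : 'I_1) a b) -(mul_delta_mx (0 : 'I_1) b a).
rewrite !mulmxA -!colE -!mulmxA -!rowE.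
by rewrite !mxE !big_ord1 !mxE [Y 0 a * _]mulrC.
Qed.

(** Matrix of the alternating form d([pfaff S 0]); the other derivative, d(da), is zero. *)
Definition torsion_mx (z : 'rV[F]_4) : 'M[F]_(3 + 4) :=
   - 2 *: wedge_mx (rshift 3 1) (lshift 4 2)
   - wedge_mx (rshift 3 2) (lshift 4 0) - wedge_mx (rshift 3 3) (lshift 4 1)
   - z 0 2 *: wedge_mx (lshift 4 0) (lshift 4 2)
   - z 0 3 *: wedge_mx (lshift 4 1) (lshift 4 2)
   - (2 * z 0 1 ^+ 2) *: wedge_mx (lshift 4 0) (lshift 4 1).

Lemma torsion_mxE z X Y :
  d1 S (pfaff S 0) z X Y = (X *m torsion_mx z *m Y^T) 0 0.
Proof.
rewrite d1_pfaff0 /wedge /dz /eta -!wedge_mxE /torsion_mx.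
(* [wedge_mx] is hidden because it unfolds to a difference. *)
move: wedge_mx => W.
by rewrite !mulmxBr !mulmxBl -!(scalemxAl, scalemxAr) !mxE.
Qed.

Lemma tr_torsion_mx z : (torsion_mx z)^T = - torsion_mx z.
Proof.
have tr a b : (wedge_mx a b)^T = - wedge_mx a b.
  by rewrite linearB /= !trmx_delta opprB.
rewrite /torsion_mx; move: wedge_mx tr => W tr.
by rewrite !linearB /= !linearZ /= !tr !scalerN.
Qed.

Lemma pfaff_row z k (E : 'M[F]_(k, 3 + 4)) r i :
  (E *m pfaff_mx z) r i = pfaff S i z (row r E).
Proof. by rewrite pfaff_mxE -row_mul [RHS]mxE. Qed.

Lemma torsion_row z k (E : 'M[F]_(k, 3 + 4)) r t :
  (E *m torsion_mx z *m E^T) r t = d1 S (pfaff S 0) z (row r E) (row t E).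
Proof.
by rewrite torsion_mxE -row_mul !mxE; apply: eq_bigr => j _; rewrite !mxE.
Qed.

(** By bilinearity it suffices to test the rows of [E]. The condition on d(d eta) follows from the
    Pfaffian one by [d2_deta]. *)
Lemma integral_element_mx z k (E : 'M[F]_(k, 3 + 4)) :
  integral_element S z E <->
  E *m pfaff_mx z = 0 /\ E *m torsion_mx z *m E^T = 0.
Proof.
split=> [[pfE dpfE _] | [pfE dpfE]]; split.
- by apply/matrixP=> r i; rewrite pfaff_row pfE ?row_sub ?mxE.
- by apply/matrixP=> r t; rewrite torsion_row dpfE ?row_sub ?mxE.
- by move=> i X /submxP[D ->]; rewrite pfaff_mxE -mulmxA pfE mulmx0 mxE.
- move=> i X Y /submxP[C ->] /submxP[D ->].
  case: (ord2P i) => ->; last exact: d1_pfaff1.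
  have EE : C *m E *m torsion_mx z *m (D *m E)^T
      = C *m (E *m torsion_mx z *m E^T) *m D^T by rewrite trmx_mul !mulmxA.
  by rewrite torsion_mxE EE dpfE mulmx0 mul0mx mxE.
- move=> i X Y Z XE YE ZE.
  have pf0 U : (U <= E)%MS -> pfaff S 0 z U = 0.
    by case/submxP=> D ->; rewrite pfaff_mxE -mulmxA pfE mulmx0 mxE.
  by rewrite d2_deta !pf0 // !mul0r subrr addr0 if_same.
Qed.

(** * Polar equations, their rank, and the integral planes *)

(** The columns are the polar equations of [E]: the two Pfaffian ones and one for each row of
    [E]. *)
Definition polar_mx z k (E : 'M[F]_(k, 3 + 4)) : 'M[F]_(3 + 4, 2 + k) :=
  row_mx (pfaff_mx z) (torsion_mx z *m E^T).

(** In the block matrix of the torsion on [col_mx E v] the [E] block vanishes by hypothesis, the [v]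
    block by alternation, and the mixed blocks agree up to sign and transposition. What remains is
    linear in [v]. *)
Lemma polar_mxP z k (E : 'M[F]_(k, 3 + 4)) (v : vec) :
  integral_element S z E ->
  (v <= kermx (polar_mx z E))%MS <-> integral_element S z (E + v)%MS.
Proof.
move=> /integral_element_mx[pfE dpfE].
have -> : integral_element S z (E + v)%MS <-> integral_element S z (col_mx E v).
  have eqE := addsmxE E v.
  by split; apply: integral_sub; rewrite eqE.
rewrite integral_element_mx; split.
  move=> /sub_kermxP; rewrite mul_mx_row => /eqP.
  rewrite row_mx_eq0 => /andP[/eqP pfv /eqP dpfv]; rewrite mulmxA in dpfv.
  rewrite tr_col_mx (mul_col_mx _ _ (pfaff_mx z)).
  rewrite (mul_col_mx _ _ (torsion_mx z)) mul_col_row pfE pfv dpfE dpfv.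
  have -> : E *m torsion_mx z *m v^T = 0.
    apply: trmx_inj; rewrite !trmx_mul trmxK tr_torsion_mx mulNmx mulmxN.
    by rewrite mulmxA dpfv oppr0 trmx0.
  have -> : v *m torsion_mx z *m v^T = 0.
    by apply/matrixP=> i j; rewrite !ord1 -torsion_mxE d1_pfaff0 /wedge mxE; ring.
  by rewrite col_mx0 block_mx0.
rewrite tr_col_mx (mul_col_mx _ _ (pfaff_mx z)).
rewrite (mul_col_mx _ _ (torsion_mx z)) mul_col_row => -[/eqP + /eqP].
rewrite col_mx_eq0 block_mx_eq0 => /andP[_ /eqP pfv] /and4P[_ _ /eqP dpfv _].
by apply/sub_kermxP; rewrite mul_mx_row pfv mulmxA dpfv row_mx0.
Qed.

(** The span of the first [k] rows of the plane; for [k <= 2], theta vanishes on it. *)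
Definition flag_mx (k : nat) (A : 'M[F]_(3, 4)) : 'M[F]_(k, 3 + 4) :=
  (pid_mx k : 'M[F]_(k, 3)) *m plane_of A.

(** The polar equations are independent: a relation among them is tested on the directions dual to
    the [dz]. *)
Lemma row_free_polar_mx z k A : (k <= 2)%N ->
  row_free (polar_mx z (flag_mx k A))^T.
Proof.
move=> k2; apply: inj_row_free => v.
rewrite -[v]hsubmxK; move: (lsubmx v) (rsubmx v) => a b {v}.
rewrite tr_row_mx mul_row_col trmx_mul trmxK tr_torsion_mx !mulmxN.
rewrite /flag_mx !mulmxA.
(* [c] holds the [eta] components of the combination of rows; its theta component is 0 because
   [k <= 2]. *)
set c := b *m pid_mx k.
have cK : c *m pid_mx k = b.
  by rewrite -mulmxA pid_mx_id ?pid_mx_1 ?mulmx1// ltnW// ltnW.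
have c2 : c 0 2 = 0.
  rewrite mxE big1 // => j _; rewrite mxE.
  have := leq_trans (ltn_ord j) k2.
  by case: eqP => [->//|]; rewrite mulr0.
move: c cK c2 => c cK c2.
have -> : c *m plane_of A = row_mx c (c *m A) by rewrite mul_mx_row mulmx1.
move: (c *m A) => d.
have pfE j : (a *m (pfaff_mx z)^T) 0 j =
    \sum_i a 0 i * pfaff S i z (delta_mx 0 j).
  rewrite mxE; apply: eq_bigr => i _.
  by rewrite pfaff_mxE -rowE !mxE.
have dpfE j : (row_mx c d *m torsion_mx z) 0 j =
    d1 S (pfaff S 0) z (row_mx c d) (delta_mx 0 j).
  by rewrite torsion_mxE trmx_delta -colE [in RHS]mxE.
move=> /eqP; rewrite subr_eq0 => /eqP v0.
have {v0 pfE dpfE} v0 j :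
    a 0 0 * pfaff S 0 z (delta_mx 0 j) + a 0 1 * pfaff S 1 z (delta_mx 0 j) =
    d1 S (pfaff S 0) z (row_mx c d) (delta_mx 0 j).
  rewrite -dpfE -v0 pfE big_ord_recl big_ord1.
  by congr (_ + a 0 _ * pfaff S _ _ _); apply: val_inj.
(* The Pfaffian forms do not involve dK1 and dK2, so these two directions isolate the terms dK1 /\
   w1 and dK2 /\ w2 of the torsion. *)
have c0 : c 0 0 = 0.
  have := v0 (rshift 3 2).
  rewrite d1_pfaff0 /= /wedge /dz /eta !row_mxEl !row_mxEr !mxE /= => E.
  by apply: (eq0_sub E); ring.
have c1 : c 0 1 = 0.
  have := v0 (rshift 3 3).
  rewrite d1_pfaff0 /= /wedge /dz /eta !row_mxEl !row_mxEr !mxE /= => E.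
  by apply: (eq0_sub E); ring.
have {c0 c1 c2} c0 : c = 0.
  by apply/rowP=> i; rewrite [RHS]mxE; case: (ord3P i) => ->.
(* With [c = 0] the torsion side vanishes on the directions of dK and da, each seen by one Pfaffian
   form. *)
have a0 : a = 0.
  apply/rowP=> i; rewrite [RHS]mxE; case: (ord2P i) => ->.
  - have := v0 (rshift 3 1).
    rewrite d1_pfaff0 /= /wedge /dz /eta !row_mxEl !row_mxEr c0 !mxE /= => E.
    by apply: (eq0_sub (esym E)); ring.
  - have := v0 (rshift 3 0).
    rewrite d1_pfaff0 /= /wedge /dz /eta !row_mxEl !row_mxEr c0 !mxE /= => E.
    by apply: (eq0_sub (esym E)); ring.
by rewrite -cK c0 mul0mx a0 row_mx0.
Qed.

(* Cartan's lemma applied to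
     (dK1 - 3 K1 theta - K^2 w2) /\ w1 + (dK2 - 3 K2 theta + K^2 w1) /\ w2 = 0. *)
Lemma integral_plane z A :
  integral_element S z (plane_of A) <->
  exists p q r, A = \matrix_(i < 3, j < 4)
    nth 0 (nth [::] [:: [:: 0; z 0 2; p; q - z 0 1 ^+ 2];
                      [:: 0; z 0 3; q + z 0 1 ^+ 2; r];
                      [:: 0; 2 * z 0 1; 3 * z 0 2; 3 * z 0 3] ] i) j.
Proof.
rewrite integral_element_mx; split=> [[/matrixP pfA /matrixP dpfA]|[p [q [r ->]]]].
  have {}pfA k i : pfaff S k z (row i (plane_of A)) = 0.
    by rewrite -pfaff_row pfA mxE.
  have {}dpfA i j :
      d1 S (pfaff S 0) z (row i (plane_of A)) (row j (plane_of A)) = 0.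
    by rewrite -torsion_row dpfA mxE.
  (* Read off from dK1 = p w1 + (q + K^2) w2 + 3 K1 theta and the w2 coefficient r of dK2. The
     torsion on rows 0, 1 then gives the w1 coefficient of dK2, and the pairs with row 2 give the
     theta coefficients. *)
  exists (A 0 2), (A 1 2 - z 0 1 ^+ 2), (A 1 3).
  have := dpfA 0 1; have := dpfA 0 2; have := dpfA 1 2.
  rewrite !d1_pfaff0 /wedge /dz /eta !row_row_mx !row_mxEl !row_mxEr !mxE /=.
  move=> E12 E02 E01.
  have A0 i : A i 0 = 0.
    by have := pfA 1 i; rewrite /= /dz row_row_mx row_mxEr mxE.
  have A1 i : A i 1 = nth 0 [:: z 0 2; z 0 3; 2 * z 0 1] i.
    have := pfA 0 i; rewrite /= /dz /eta row_row_mx row_mxEr !row_mxEl !mxE.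
    move=> E; apply/eqP; rewrite -subr_eq0; apply/eqP; move: E.
    by case: (ord3P i) => -> /= E; apply: (eq0_sub (esym E)); ring.
  rewrite !A1 /= in E12 E02 E01.
  apply/matrixP=> i j; rewrite [RHS]mxE.
  apply/eqP; rewrite -subr_eq0; apply/eqP.
  by case: (ord3P i) => ->; case: (ord4P j) => ->;
    rewrite ?A0 ?A1 /= ?subrr ?subrK //;
    [apply: (eq0_sub E01)|idtac|apply: (eq0_sub (esym E02))
    |apply: (eq0_sub (esym E12))]; ring.
split; apply/matrixP=> i j.
  rewrite pfaff_row mxE.
  by case: (ord2P j) => ->; case: (ord3P i) => ->;
    rewrite /= /dz /eta row_row_mx ?row_mxEl ?row_mxEr !mxE /=; ring.
rewrite torsion_row d1_pfaff0 /wedge /dz /eta.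
rewrite !row_row_mx !row_mxEl !row_mxEr !mxE.
by case: (ord3P i) => ->; case: (ord3P j) => -> /=; ring.
Qed.

(** * Cartan characters *)

(** The polar space is the kernel of [polar_mx], so rank-nullity applies. *)
Lemma polar_codim_rank z k (E : 'M[F]_(k, 3 + 4)) c :
  integral_element S z E -> polar_codim S z E c <-> c = \rank (polar_mx z E).
Proof.
move=> iE; split=> [[H HP rH]|->].
  have : (H == kermx (polar_mx z E))%MS.
    by apply/andP; split; apply/rV_subP => v; rewrite HP (polar_mxP _ iE).
  move=> /eqmxP eqH; move: rH; rewrite eqH mxrank_ker => rH; apply/eqP.
  rewrite -(eqn_add2l (3 + 4 - \rank (polar_mx z E))) rH subnK //.
  exact: rank_leq_row.
exists (kermx (polar_mx z E)) => [v|]; first exact: polar_mxP.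
by rewrite mxrank_ker subnK // rank_leq_row.
Qed.

(** The value at 3 is the default 0 of [nth]. *)
Definition NW_char (j : nat) : nat := nth 0 [:: 2; 1; 1] j.

(** There are [2 + k] polar equations, which bounds every polar codimension; [flag_mx] attains the
    bound. *)
Lemma NW_characters z A : integral_element S z (plane_of A) ->
  cartan_characters S z (plane_of A) NW_char.
Proof.
move=> iA; split; last by rewrite !big_ord_recr big_ord0.
move=> k k3.
have sumE : (\sum_(j < k.+1) NW_char j = 2 + k)%N.
  by case: k k3 => [|[|[|//]]] _; rewrite !big_ord_recr big_ord0.
have plane_free : row_free (plane_of A).
  apply: inj_row_free => v; rewrite mul_mx_row mulmx1 => /eqP.
  by rewrite row_mx_eq0 => /andP[/eqP].
rewrite sumE; split.
  exists (flag_mx k A).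
  have sF : (flag_mx k A <= plane_of A)%MS by exact: submxMl.
  split=> //.
    by rewrite /row_free mxrankMfree // rank_pid_mx // ltnW.
  apply/(polar_codim_rank _ (integral_sub sF iA)).
  by apply/esym; rewrite -mxrank_tr; apply/eqP; exact: row_free_polar_mx.
move=> F' c _ sF /(polar_codim_rank _ (integral_sub sF iA)) ->.
exact: rank_leq_col.
Qed.

(** * Cartan's test *)

(** Symmetric 2 x 2 matrices, placed as the w1, w2 coefficients of dK1, dK2. *)
Definition sym_part (u : 'rV[F]_3) : 'M[F]_(3, 4) :=
  u 0 0 *: delta_mx 0 2 + u 0 1 *: (delta_mx 0 3 + delta_mx 1 2)
  + u 0 2 *: delta_mx 1 3.

Fact sym_part_is_linear : linear sym_part.
Proof.
by move=> a u v; apply/matrixP=> i j; rewrite !mxE; ring.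
Qed.

HB.instance Definition _ :=
  GRing.isLinear.Build F _ _ _ sym_part sym_part_is_linear.

Lemma NW_involution z : in_involution_at S z NW_char.
Proof.
(* The origin of the affine space is the integral plane p = q = r = 0. *)
exists (\matrix_(i < 3, j < 4)
    nth 0 (nth [::] [:: [:: 0; z 0 2; 0; - z 0 1 ^+ 2];
                      [:: 0; z 0 3; z 0 1 ^+ 2; 0];
                      [:: 0; 2 * z 0 1; 3 * z 0 2; 3 * z 0 3] ] i) j).
exists (limg (linfun sym_part)); split.
- move=> A; rewrite integral_plane; split=> [[p [q [r ->]]]|/memv_imgP[u _]].
    apply/memv_imgP; exists (\row_i [:: p; q; r]`_i); rewrite ?memvf // lfunE /=.
    apply/matrixP=> i j; rewrite !mxE.
    by case: (ord3P i) => ->; case: (ord4P j) => -> /=; ring.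
  rewrite lfunE /= => /eqP; rewrite subr_eq => /eqP ->.
  exists (u 0 0), (u 0 1), (u 0 2); apply/matrixP=> i j; rewrite !mxE.
  by case: (ord3P i) => ->; case: (ord4P j) => -> /=; ring.
- exact: NW_characters.
(* [sym_part] is injective: its three parameters are entries of the matrix. *)
have ->: \dim (limg (linfun sym_part)) = \dim {:'rV[F]_3}.
  apply: limg_dim_eq; apply/eqP; rewrite -subv0; apply/subvP=> u.
  rewrite memv_cap => /andP[_]; rewrite memv_ker lfunE /= memv0 => /eqP/matrixP u0.
  apply/eqP/rowP=> i; case: (ord3P i) => ->.
  - by have := u0 0 2; rewrite !mxE /= => E; apply: (eq0_sub (esym E)); ring.
  - by have := u0 0 3; rewrite !mxE /= => E; apply: (eq0_sub (esym E)); ring.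
  - by have := u0 1 3; rewrite !mxE /= => E; apply: (eq0_sub (esym E)); ring.
by rewrite dimvf dim_matrix !big_ord_recr big_ord0.
Qed.

Lemma NW_general_solution : general_solution_depends_on S 1 2.
Proof.
exists NW_char; split=> //; first by move=> z _; exact: NW_involution.
by case=> [|[|[|[|]]]].
Qed.

End NWSystem.

(** * The flat web of parallel lines *)

Section FlatWeb.
Variable K : numFieldType.

(** First integral of the foliation defined by the constant form [u]. *)
Definition lform (u p : 'rV[K]_2) : K := u 0 0 * p 0 0 + u 0 1 * p 0 1.

Lemma lformE u p : lform u p = \sum_(i < 2) u 0 i * p 0 i.
Proof.
rewrite big_ord_recl big_ord1 /lform.
by congr (_ + u 0 _ * p 0 _); apply: val_inj.
Qed.

Lemma smooth_cst D (c : K) : smooth D (fun=> c).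
Proof.
move=> k; elim: k c => [|k IHk] c; split=> //.
- by move=> p _; exact: cst_continuous.
- by move=> p _; exact: cst_continuous.
move=> i; split; first by move=> p _; exact: derivable_cst.
rewrite (_ : partial i _ = fun=> 0) //.
by apply/funext=> p; exact: derive_cst.
Qed.

Lemma dform_cst (u p : 'rV[K]_2) : dform (fun=> u) p = 0.
Proof.
have p0 i (c : K) : partial i (fun=> c) p = 0 by exact: derive_cst.
by rewrite /dform !p0 subrr.
Qed.

(** The signs make the first three forms sum to zero and give - w_3 = - w_0 + w_1, so the basic
    invariant is -1. *)
Definition flat_form (i : 'I_4) : 'rV[K]_2 :=
  \row_j (nth [::] [:: [:: 1; 0]; [:: 0; 1]; [:: -1; -1]; [:: 1; -1]] i)`_j.

Lemma flat_form_wedge i j : i != j -> wedge1 (flat_form i) (flat_form j) != 0.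
Proof.
rewrite /wedge1 !mxE.
by case: (ord4P i) => ->; case: (ord4P j) => -> //= _;
  rewrite ?(mulr0, mul0r, mulr1, mul1r, subr0, sub0r, opprK, mulrN1, mulrN);
  rewrite ?oppr_eq0 ?oner_eq0.
Qed.

(** Cramer's rule. *)
Lemma wedge1_lform (u v p q : 'rV[K]_2) : wedge1 u v != 0 ->
  lform u p = lform u q -> lform v p = lform v q -> p = q.
Proof.
rewrite /lform /wedge1 => uv.
move=> /eqP; rewrite -subr_eq0 => /eqP Eu /eqP; rewrite -subr_eq0 => /eqP Ev.
apply/rowP=> i; apply: (mulfI uv); apply/eqP; rewrite -subr_eq0; apply/eqP.
case: (ord2P i) => ->.
  rewrite -[RHS](mulr0 (v 0 1)) -[in RHS]Eu.
  by rewrite -[RHS]subr0 -[in RHS](mulr0 (u 0 1)) -[in RHS]Ev; ring.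
rewrite -[RHS](mulr0 (u 0 0)) -[in RHS]Ev.
by rewrite -[RHS]subr0 -[in RHS](mulr0 (v 0 0)) -[in RHS]Eu; ring.
Qed.

(** Provides the constant factors that normalize three constant forms to zero sum. *)
Lemma wedge1_cycle (u v w : 'rV[K]_2) :
  wedge1 v w *: u + wedge1 w u *: v + wedge1 u v *: w = 0.
Proof.
by apply/rowP=> i; rewrite /wedge1 !mxE; case: (ord2P i) => ->; ring.
Qed.

(** The two hypotheses isolate the analysis over the ground field; the rest is linear algebra with
    constant forms. *)
Lemma flat_web_exists :
  (forall (x : 'rV[K]_2) r, 0 < r -> connected (ball x r)) ->
  (forall D (u p q : 'rV[K]_2),
     same_leaf D (fun=> u) p q -> lform u p = lform u q) ->
  NW_webs_exist K.
Proof.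
move=> ball_conn leaf_cst U oU [x Ux].
have /nbhs_ballP[r /= r0 rU] : nbhs x U by exact: open_nbhs_nbhs.
exists (ball x r), (fun i => fun=> flat_form i); split=> //.
have sm (u : 'rV[K]_2) : smooth_form (ball x r) (fun=> u).
  by move=> i; exact: smooth_cst.
have resc J (X : J -> 'rV[K]_2) (c : J -> K) : (forall j, c j != 0) ->
    rescaling (ball x r) (fun j => fun=> X j) (fun j => fun=> c j *: X j).
  move=> c0 j; split=> //; exists (fun=> c j); first exact: smooth_cst.
  by move=> p _; split.
split.
- split; [exact: ball_open|exact: ball_conn|by exists x; exact: ballxx|].
  split=> [i|i j ij]; first exact: sm.
  split=> [p _|p q pqi pqj]; first exact: flat_form_wedge.
  apply: wedge1_lform (flat_form_wedge ij) _ _.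
    exact: leaf_cst pqi.
  exact: leaf_cst pqj.
- exists (-1); split; first exact: smooth_cst.
  exists (fun i => fun=> flat_form i); split.
  + move=> i; split; first exact: sm.
    exists (fun=> 1); first exact: smooth_cst.
    by move=> p _; rewrite scale1r oner_neq0.
  + by move=> p _; apply/rowP=> j; case: (ord2P j) => ->; rewrite !mxE /=; ring.
  + by move=> p _; apply/rowP=> j; case: (ord2P j) => ->; rewrite !mxE /=; ring.
exists (fun=> 0) => i.
pose X j := flat_form (lift i j).
(* Indices are modulo 3: each form is scaled by the wedge of the two others in cyclic order. *)
pose c (j : 'I_3) := wedge1 (X (j + 1)) (X (j + 2)).
exists (fun j => fun=> c j *: X j), (fun=> 0); split.
- apply: resc => j; apply: flat_form_wedge; rewrite (inj_eq lift_inj).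
  by case: j => -[|[|[|//]]].
- move=> p _; rewrite !big_ord_recl big_ord0 /c.
  rewrite addr0 addrA -(wedge1_cycle (X 0) (X 1) (X 2)).
  by congr (wedge1 (X _) (X _) *: X _ + wedge1 (X _) (X _) *: X _
            + wedge1 (X _) (X _) *: X _); apply: val_inj.
- exact: sm.
- by move=> j p _; rewrite dform_cst /wedge1 !mxE; ring.
- by move=> p _; rewrite dform_cst.
Qed.

End FlatWeb.

(** * First integrals and connected balls, uniformly over the real and complex fields *)

Section RealCoordinates.
(* [e] embeds the reals in [K], and the [rho i] are the coordinates of [K] over
   the reals: the identity for [K = R], and Re, Im for [K = R[i]]. *)
Variables (R : realType) (K : numFieldType) (e : {rmorphism R -> K}).
Hypothesis e_le : {mono e : x y / x <= y}.
Hypothesis e_norm : forall t, `|e t| = e `|t|.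
Hypothesis e_pos : forall x : K, 0 < x -> exists t, x = e t.
Variables (I : Type) (rho : I -> K -> R).
Hypothesis rhoB : forall i x y, rho i (x - y) = rho i x - rho i y.
Hypothesis rhoZ : forall i t x, rho i (e t * x) = t * rho i x.
Hypothesis rho_norm : forall i x, e `|rho i x| <= `|x|.
Hypothesis rho_eq0 : forall x, (forall i, rho i x = 0) -> x = 0.

Let e_lt : {mono e : x y / x < y}.
Proof. exact: leW_mono. Qed.

Let e_cvg : continuous (e : R -> K).
Proof.
move=> t; apply/cvgrPdist_lt => eps eps0.
have [d dE] := e_pos eps0.
have d0 : 0 < d by rewrite -e_lt -dE rmorph0.
near=> x; rewrite -rmorphB /= e_norm dE e_lt.
by near: x; apply: (cvgrPdist_lt _ _).1 d0; exact: cvg_id.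
Unshelve. all: by end_near. Qed.

Let rho_cvg i : continuous (rho i : K^o -> R^o).
Proof.
move=> x.
apply/(@cvgrPdist_lt _ R^o _ (nbhs (x : K^o)) (nbhs_filter _)) => eps eps0.
have eeps0 : 0 < e eps by rewrite -(rmorph0 e) e_lt.
near=> y; rewrite -rhoB -e_lt; apply: le_lt_trans (rho_norm _ _) _.
near: y.
apply: (@cvgrPdist_lt _ K^o _ (nbhs (x : K^o)) (nbhs_filter _) _ _).1 eeps0.
exact: cvg_id.
Unshelve. all: by end_near. Qed.

(** The mean value theorem is applied to each real coordinate of [f] along the segment from 0 to
    [s]. *)
Lemma cst_of_derive0 (f : K -> K) (r s : K) : `|s| < r ->
  (forall t : K, `|t| < r -> derivable (f : K^o -> K^o) t 1 /\
     derive (f : K^o -> K^o) t 1 = 0) ->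
  f s = f 0.
Proof.
(* For [s != 0] the map k -> [e k * s] preserves punctured neighbourhoods of 0. *)
move=> sr f0; have [->//|s0] := eqVneq s 0.
apply/eqP; rewrite -subr_eq0; apply/eqP/rho_eq0 => i; rewrite rhoB.
pose g t : R := rho i (f (e t * s)).
have -> : rho i (f s) - rho i (f 0) = g 1 - g 0.
  by rewrite /g rmorph1 rmorph0 mul1r mul0r.
have Dg (t : R) : t \in `[0, 1] -> is_derive t (1 : R) (g : R -> R) 0.
  rewrite in_itv /= => /andP[t0 t1]; set p := e t * s.
  have pr : `|p| < r.
    apply: le_lt_trans sr; rewrite normrM e_norm (ger0_norm t0) ler_piMl //.
    by rewrite -(rmorph1 e) e_le.
  have [df df0] := f0 _ pr.
  pose q (h : K^o) : K^o := h^-1 *: ((f \o shift p) (h *: 1) - f p).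
  have cf : q @ 0^' --> derive (f : K^o -> K^o) p 1 by exact: df.
  rewrite df0 in cf.
  have ce : (fun k : R => e k * s) @ (0 : R)^' --> (0 : K^o)^'.
    have cz : (fun k : R => e k * s : K^o) @ (0 : R) --> (0 : K^o).
      have := @cvgM K R _ _ _ (fun=> s) _ _ (@e_cvg 0) (cvg_cst _).
      by rewrite rmorph0 mul0r; apply.
    move=> P P0.
    have N : \forall k \near (0 : R), e k * s != 0 -> P (e k * s).
      exact: (cz _ P0).
    suff : \forall k \near (0 : R), k != 0 -> P (e k * s) by [].
    apply: filterS N => k Pk k0; apply: Pk.
    by rewrite mulf_neq0 // fmorph_eq0.
  have cq : (fun k : R => s * q (e k * s)) @ (0 : R)^' --> (s * 0 : K^o).
    apply: (@cvgM K); first exact: cvg_cst.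
    exact: cvg_comp ce cf.
  (* Chain rule: the quotient of [g] is [rho i] of [s] times the quotient of [f] with increment
     [e k * s]. *)
  have cg : (fun k => k^-1 *: ((g \o shift t) (k *: 1) - g t) : R^o)
      @ (0 : R)^' --> (rho i (s * 0) : R^o).
    rewrite (_ : (fun k => _) = rho i \o (fun k : R => s * q (e k * s))).
      exact: cvg_comp cq (@rho_cvg i _).
    apply/funext => k /=; rewrite /q /g /shift /= /GRing.scale /= !mulr1.
    have sV x : s * ((e k * s)^-1 * x) = e k^-1 * x.
      by rewrite mulrA invfM mulrCA mulfV // mulr1 fmorphV.
    by rewrite sV rhoZ rhoB rmorphD mulrDl.
  have rho0 : rho i (s * 0) = 0.
    by rewrite mulr0 -[X in rho i X](subrr 0) rhoB subrr.
  rewrite rho0 in cg.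
  split; first by apply/cvg_ex; exists 0.
  exact: cvg_lim.
have cg : {within `[0, 1], continuous g}.
  apply: derivable_within_continuous => x x01.
  by have [] := Dg _ x01.
have Dg' (x : R) : x \in `]0, 1[ ->
    is_derive x (1 : R) (g : R -> R) ((fun=> 0) x).
  by move=> x01; apply: Dg; exact: subset_itv_oo_cc.
have [c _ ->] := @MVT_segment R g (fun=> 0) 0 1 ler01 Dg' cg.
by rewrite mul0r.
Qed.

(** The ball is the union of real segments that all contain its centre. *)
Lemma ball_connected (V : normedModType K) (x : V) (r : K) :
  0 < r -> connected (ball x r).
Proof.
move=> r0.
pose seg y := (fun t : R => x + e t *: (y - x)) @` `[0, 1].
have segx y : seg y x.
  by exists 0; rewrite /= ?in_itv /= ?lexx ?ler01 // rmorph0 scale0r addr0.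
have -> : ball x r = \bigcup_(y in ball x r) seg y.
  apply/seteqP; split=> [y xy|z [y]].
    exists y => //; exists 1; rewrite /= ?in_itv /= ?lexx ?ler01 //.
    by rewrite rmorph1 scale1r addrC subrK.
  rewrite -ball_normE /ball_ /= => xy [t] /=.
  rewrite in_itv /= => /andP[t0 t1] <-.
  rewrite opprD addrA subrr sub0r normrN normrZ e_norm ger0_norm // distrC.
  apply: le_lt_trans xy; rewrite ler_piMl //.
  by rewrite -(rmorph1 e) e_le.
apply: bigcup_connected; first by exists x => y _; exact: segx.
move=> y _; apply: connected_continuous_connected.
  exact: segment_connected.
apply: continuous_subspaceT => t; apply: cvgD; first exact: cvg_cst.
by apply: cvgZr_tmp; exact: e_cvg.
Qed.

(** By linearity the derivative of [lform u] along the arc is [lform u] of the velocity, which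
    vanishes on an integral curve. *)
Lemma integral_arc_cst D (u p q : 'rV[K]_2) :
  integral_arc D (fun=> u) p q -> lform u p = lform u q.
Proof.
move=> [c [r [s [sr <- <- cP]]]]; apply/esym.
apply: (@cst_of_derive0 (lform u \o c) r) => // t tr.
have [_ dc uc] := cP t tr.
pose dq (h : K^o) := h^-1 *: ((c \o shift t) (h *: 1) - c t).
have {dc} cc : dq @ 0^' --> derive (c : K^o -> _) t 1 by exact: dc.
have cl : continuous (lform u : 'rV[K]_2 -> K^o).
  move=> x.
  have cM a i : (fun p : 'rV[K]_2 => a * p 0 i : K) @ x --> (a * x 0 i : K).
    exact: (@cvgM K _ _ _ (fun=> a) (fun p : 'rV[K]_2 => p 0 i) _ _
      (cvg_cst _) (@coord_continuous K 1 2 0 i x)).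
  exact: (@cvgD K K^o _ _ _ _ _ _ _ (cM _ _) (cM _ _)).
have cf : (fun h => h^-1 *: (((lform u \o c) \o shift t) (h *: 1)
      - (lform u \o c) t)) @ (0 : K^o)^'
    --> (lform u (derive (c : K^o -> _) t 1) : K^o).
  rewrite (_ : (fun h => _) = lform u \o dq); first exact: cvg_comp cc (@cl _).
  by apply/funext => h; rewrite /lform /= !mxE /GRing.scale /=; ring.
rewrite lformE uc in cf.
split; first by apply/cvg_ex; exists 0.
exact: cvg_lim.
Qed.

Lemma same_leaf_cst D (u p q : 'rV[K]_2) :
  same_leaf D (fun=> u) p q -> lform u p = lform u q.
Proof.
by case=> _; elim=> [x y /integral_arc_cst|//|x y z _ -> _ ->].
Qed.

Lemma NW_webs_exist_over : NW_webs_exist K.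
Proof. apply: flat_web_exists; [exact: ball_connected|exact: same_leaf_cst]. Qed.

End RealCoordinates.

(** * The real and complex cases *)

Lemma NW_webs_exist_real (R : realType) : NW_webs_exist R.
Proof.
apply: (@NW_webs_exist_over R R idfun _ _ _ unit (fun _ => idfun)) => //=.
- by move=> x _; exists x.
- by move=> x /(_ tt).
Qed.

Lemma NW_webs_exist_complex (R : realType) : NW_webs_exist R[i]%C.
Proof.
apply: (@NW_webs_exist_over R R[i]%C (real_complex R) _ _ _ bool
  (fun b z => if b then complex.Re z else complex.Im z)) => /=.
- exact: lecR.
- by move=> t; rewrite normc_def /= expr0n addr0 sqrtr_sqr.
- by move=> x x0; apply/complex_realP; rewrite gtr0_real.
- by move=> [] [a b] [c d].
- by move=> [] t [a b] /=; rewrite ?mul0r ?subr0 ?addr0.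
- move=> [] x; first exact: normc_ge_Re.
  by rewrite normc_def lecR -sqrtr_sqr ler_wsqrtr // lerDr sqr_ge0.
- by move=> [a b] z0; have /= -> := z0 true; have /= -> := z0 false.
Qed.

Theorem proposition15 (R : realType) :
  (NW_webs_exist R /\
   general_solution_depends_on (NW_system R) 1 2) /\
  (NW_webs_exist R[i]%C /\
   general_solution_depends_on (NW_system R[i]%C) 1 2).
Proof.
split; split; [exact: NW_webs_exist_real|exact: NW_general_solution|
  exact: NW_webs_exist_complex|exact: NW_general_solution].
Qed.
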